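(* Let $\mathbb A$ be an algebra on $\mathbb R^n$ with structure constants $c_{ijk}$, let $\varphi=(\varphi_1,\dots,\varphi_n):U\subset\mathbb R^k\to\mathbb R^n$ be a differentiable function on an open set $U$, and let $f=(f_1,\dots,f_n):U\to\mathbb R^n$ be a $\varphi\mathbb A$-differentiable function. Then the $\varphi\mathbb A$-Cauchy-Riemann equations, i.e. the linear system of partial differential equations obtained from $$d\varphi(e_j)\,f_{u_i}=d\varphi(e_i)\,f_{u_j},\qquad i,j\in\{1,\dots,k\},$$ are given by $$\sum_{m=1}^n\sum_{l=1}^n\left(f_{mu_i}\varphi_{lu_j}-f_{mu_j}\varphi_{lu_i}\right)c_{lmq}=0\qquad\text{for } 1\le i<j\le k,\ q=1,\dots,n,$$ which is a system of $n(k-1)!$ partial differential equations.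
   Context: An algebra $\mathbb A$ on $\mathbb R^n$ is the real linear space $\mathbb R^n$ with a bilinear, associative, commutative product having a unit $e$; its structure constants are defined by $e_ie_j=\sum_{k=1}^n c_{ijk}e_k$ for the canonical basis. For $f,\varphi:U\subset\mathbb R^k\to\mathbb R^n$ differentiable in the usual sense, $f$ is $\varphi\mathbb A$-differentiable on $U$ if there is a function $f'_\varphi:U\to\mathbb R^n$ such that $df_u(\xi)=f'_\varphi(u)\,d\varphi_u(\xi)$ ($\mathbb A$-product) for all $u\in U$, $\xi\in\mathbb R^k$. Here $u=(u_1,\dots,u_k)$ are the coordinates of $\mathbb R^k$, $f_{mu_i}=\partial f_m/\partial u_i$, $f_{u_i}=\sum_m f_{mu_i}e_m$, $\varphi_{lu_i}=\partial\varphi_l/\partial u_i$, $d\varphi(e_i)=\sum_{l}\varphi_{lu_i}e_l$ (with $e_i\in\mathbb R^k$ on the left and $e_l\in\mathbb R^n$ on the right), and $d\varphi(e_j)f_{u_i}$ is an $\mathbb A$-product.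
   Formalization: The number of equations n(k-1)! is replaced by n(1+2+...+(k-1)) = nk(k-1)/2, the actual number of equations with 1 ≤ i < j ≤ k, q = 1,...,n; the factorial count fails, e.g. for k = 3, n = 1 (3 equations, not 2). *)

(* Defs.v *)
From HB Require Import structures.
From mathcomp Require Import all_boot all_order all_algebra.
From mathcomp Require Import all_classical all_reals all_analysis.

Set Implicit Arguments.
Unset Strict Implicit.
Unset Printing Implicit Defensive.

Import Order.TTheory GRing.Theory Num.Theory.
Import numFieldNormedType.Exports.

Local Open Scope ring_scope.

Record algebra_on (R : realType) (n : nat) := AlgebraOn {
  amul : {bilinear 'rV[R]_n -> 'rV[R]_n -> 'rV[R]_n};
  aone : 'rV[R]_n;
  amulA : associative amul;
  amulC : commutative amul;
  amul1 : left_id aone amul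
}.

Definition ebase (R : realType) (n : nat) (i : 'I_n) : 'rV[R]_n := delta_mx 0 i.
Arguments ebase {R n} i.

Definition structure_constants (R : realType) (n : nat) (A : algebra_on R n)
    (c : 'I_n -> 'I_n -> 'I_n -> R) : Prop :=
  forall i j, amul A (ebase i) (ebase j) = \sum_(q < n) c i j q *: ebase q.

Definition differentiable_on (R : realType) (k n : nat) (U : set 'rV[R]_k)
    (f : 'rV[R]_k -> 'rV[R]_n) : Prop :=
  forall u, U u -> differentiable f u.

(* Functions on U are represented by total functions; since U is open, their
   differentials at points of U do not depend on the values outside U. *)
Definition phiA_differentiable (R : realType) (k n : nat) (A : algebra_on R n)
    (U : set 'rV[R]_k) (phi f : 'rV[R]_k -> 'rV[R]_n) : Prop :=
  [/\ differentiable_on U phi, differentiable_on U f &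
      exists f' : 'rV[R]_k -> 'rV[R]_n,
        forall u, U u -> forall xi : 'rV[R]_k,
          'd f u xi = amul A (f' u) ('d phi u xi)].

(* [partial f m i u] is f_{m u_i}(u), and [dvec f i u] is f_{u_i}(u). *)
Definition partial (R : realType) (k n : nat) (f : 'rV[R]_k -> 'rV[R]_n)
    (m : 'I_n) (i : 'I_k) (u : 'rV[R]_k) : R :=
  'D_(ebase i) (fun v => f v 0 m) u.

Definition dvec (R : realType) (k n : nat) (f : 'rV[R]_k -> 'rV[R]_n)
    (i : 'I_k) (u : 'rV[R]_k) : 'rV[R]_n :=
  \sum_(m < n) partial f m i u *: ebase m.

Definition CR_product_system (R : realType) (k n : nat) (A : algebra_on R n)
    (U : set 'rV[R]_k) (phi g : 'rV[R]_k -> 'rV[R]_n) : Prop :=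
  forall u, U u -> forall i j : 'I_k,
    amul A ('d phi u (ebase j)) (dvec g i u)
    = amul A ('d phi u (ebase i)) (dvec g j u).

Definition CR_lhs (R : realType) (k n : nat) (c : 'I_n -> 'I_n -> 'I_n -> R)
    (phi g : 'rV[R]_k -> 'rV[R]_n) (i j : 'I_k) (q : 'I_n) (u : 'rV[R]_k) : R :=
  \sum_(m < n) \sum_(l < n)
    (partial g m i u * partial phi l j u
     - partial g m j u * partial phi l i u) * c l m q.

Definition CR_index (k n : nat) : {set 'I_k * 'I_k * 'I_n} :=
  [set t : 'I_k * 'I_k * 'I_n | (t.1.1 < t.1.2)%N]%SET.

Definition CR_system (R : realType) (k n : nat) (c : 'I_n -> 'I_n -> 'I_n -> R)
    (U : set 'rV[R]_k) (phi g : 'rV[R]_k -> 'rV[R]_n) : Prop :=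
  forall t, t \in CR_index k n ->
  forall u, U u -> CR_lhs c phi g t.1.1 t.1.2 t.2 u = 0.

(* Main.v *)
Require Import Defs.
From HB Require Import structures.
From mathcomp Require Import all_boot all_order all_algebra.
From mathcomp Require Import all_classical all_reals all_analysis.

Set Implicit Arguments.
Unset Strict Implicit.
Unset Printing Implicit Defensive.

Import Order.TTheory GRing.Theory Num.Theory.
Import numFieldNormedType.Exports.

Local Open Scope ring_scope.

(** By the chain [f_{u_i} = df(e_i) = f' dphi(e_i)], both sides of the product equation are the
    product of [f'], [dphi(e_i)] and [dphi(e_j)], so commutativity and associativity make them equal
    ([phiA_differentiable_CR]). Expanding the products by bilinearity in the canonical basis turns
    the q-th coordinate of the difference of the sides into the displayed expression
    ([CR_lhs_coord]). That expression is antisymmetric in i and j, so the equations with i < j imply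
    all the others ([CR_product_systemE]), and it remains to count these. *)

Lemma partialE (R : realType) (k n : nat) (f : 'rV[R]_k -> 'rV[R]_n)
    (m : 'I_n) (i : 'I_k) (u : 'rV[R]_k) :
  differentiable f u -> partial f m i u = 'd f u (ebase i) 0 m.
Proof.
move=> df; rewrite -deriveE // derive_mx; last exact: diff_derivable.
by rewrite mxE.
Qed.

Lemma dvecE (R : realType) (k n : nat) (f : 'rV[R]_k -> 'rV[R]_n)
    (i : 'I_k) (u : 'rV[R]_k) :
  differentiable f u -> dvec f i u = 'd f u (ebase i).
Proof.
move=> df; rewrite [RHS]row_sum_delta.
by apply: eq_bigr => m _; rewrite partialE.
Qed.

Lemma amul_coord (R : realType) (n : nat) (A : algebra_on R n)
    (c : 'I_n -> 'I_n -> 'I_n -> R) (a b : 'I_n -> R) (q : 'I_n) :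
  structure_constants A c ->
  amul A (\sum_l a l *: ebase l) (\sum_m b m *: ebase m) 0 q
  = \sum_m \sum_l b m * a l * c l m q.
Proof.
move=> hc; rewrite linear_sumr summxE; apply: eq_bigr => m _.
rewrite linear_sumlz summxE; apply: eq_bigr => l _.
rewrite linearZr_LR linearZl_LR hc !mxE /= summxE (bigD1 q) //= big1 => [|r rq].
  by rewrite !mxE !eqxx mulr1 addr0 mulrA.
by rewrite !mxE eq_sym (negPf rq) andbF mulr0.
Qed.

Lemma CR_lhs_coord (R : realType) (k n : nat) (A : algebra_on R n)
    (c : 'I_n -> 'I_n -> 'I_n -> R) (phi g : 'rV[R]_k -> 'rV[R]_n)
    (u : 'rV[R]_k) (i j : 'I_k) (q : 'I_n) :
  structure_constants A c -> differentiable phi u ->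
  (amul A ('d phi u (ebase j)) (dvec g i u)
   - amul A ('d phi u (ebase i)) (dvec g j u)) 0 q
  = CR_lhs c phi g i j q u.
Proof.
move=> hc dphi; rewrite -!dvecE // mxE [X in _ + X]mxE !(amul_coord _ _ _ hc).
rewrite -sumrB; apply: eq_bigr => m _.
by rewrite -sumrB; apply: eq_bigr => l _; rewrite -mulrBl.
Qed.

(** Swapping i and j changes the sign of the bracket in every summand; this is what allows the
    system to be indexed by i < j only. *)
Lemma CR_lhs_anti (R : realType) (k n : nat) (c : 'I_n -> 'I_n -> 'I_n -> R)
    (phi g : 'rV[R]_k -> 'rV[R]_n) (i j : 'I_k) (q : 'I_n) (u : 'rV[R]_k) :
  CR_lhs c phi g j i q u = - CR_lhs c phi g i j q u.
Proof.
rewrite -sumrN; apply: eq_bigr => m _; rewrite -sumrN.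
by apply: eq_bigr => l _; rewrite -[RHS]mulNr opprB.
Qed.

Lemma CR_product_systemE (R : realType) (k n : nat) (A : algebra_on R n)
    (c : 'I_n -> 'I_n -> 'I_n -> R) (U : set 'rV[R]_k)
    (phi g : 'rV[R]_k -> 'rV[R]_n) :
  structure_constants A c -> differentiable_on U phi ->
  CR_product_system A U phi g <-> CR_system c U phi g.
Proof.
move=> hc dphi; split=> [H [[i j] q] _ u Uu|H u Uu i j].
  by rewrite -(CR_lhs_coord _ _ _ _ hc (dphi u Uu)) H // subrr mxE.
apply/eqP; rewrite -subr_eq0; apply/eqP/rowP => q.
rewrite (CR_lhs_coord _ _ _ _ hc (dphi u Uu)) mxE.
have Hlt (i' j' : 'I_k) : (i' < j')%N -> CR_lhs c phi g i' j' q u = 0.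
  by move=> ij; apply: (H (i', j', q)) => //; rewrite inE.
(* Pairs with i > j reduce to i < j by antisymmetry; on the diagonal every bracket cancels. *)
case: (ltngtP i j) => [/Hlt //|/Hlt ji|/val_inj ->].
  by rewrite CR_lhs_anti ji oppr0.
rewrite /CR_lhs big1 // => m _.
by rewrite big1 // => l _; rewrite subrr mul0r.
Qed.

(** Used with x = [f' u], y = [dphi(e_j)] and z = [dphi(e_i)]. *)
Lemma amul_exchange (R : realType) (n : nat) (A : algebra_on R n) (x y z : 'rV[R]_n) :
  amul A y (amul A x z) = amul A z (amul A x y).
Proof. by rewrite amulA (amulC A y x) amulC. Qed.

Lemma phiA_differentiable_CR (R : realType) (k n : nat) (A : algebra_on R n)
    (U : set 'rV[R]_k) (phi f : 'rV[R]_k -> 'rV[R]_n) :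
  phiA_differentiable A U phi f -> CR_product_system A U phi f.
Proof.
case=> _ df [f' Hf'] u Uu i j; rewrite !dvecE; try exact: df.
(* Rewriting with [Hf'] diverges: unification unfolds the differentials. *)
apply: etrans (congr1 _ (Hf' u Uu _)) _.
apply: etrans (esym (congr1 _ (Hf' u Uu _))).
exact: amul_exchange.
Qed.

(** There are 1 + ... + (k - 1) = k(k - 1)/2 pairs i < j, each giving n equations. The symbol (k -
    1)! has to be read as this sum: for k = 3 it is 3, while the usual factorial is 2. *)
Lemma card_CR_index (k n : nat) :
  #|CR_index k n| = (n * \sum_(1 <= i < k) i)%N.
Proof.
have -> : CR_index k n
    = finset.setX [set p : 'I_k * 'I_k | (p.1 < p.2)%N]%SET [set: 'I_n]%SET.
  by apply/setP => -[p q]; rewrite !inE andbT.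
rewrite cardsX cardsT card_ord mulnC; congr (n * _)%N.
(* The index 0 contributes nothing; k = 0 is separate because then there is no index 0 to split
   off. *)
have -> : (\sum_(1 <= i < k) i = \sum_(j < k) j)%N.
  case: k => [|k]; first by rewrite big_geq // big_ord0.
  by rewrite -(big_mkord xpredT id) [RHS]big_ltn // add0n.
(* Count the pairs by their larger entry j: exactly j indices lie below it. *)
rewrite -sum1dep_card -(pair_big_dep xpredT (fun i j : 'I_k => (i < j)%N)
  (fun _ _ => 1%N)) /= (exchange_big_dep xpredT) //=.
apply: eq_bigr => j _.
by rewrite (big_ord_narrow (ltnW (ltn_ord j))) sum1_card card_ord.
Qed.

Theorem theorem1p1 (R : realType) (k n : nat) (A : algebra_on R n)
    (c : 'I_n -> 'I_n -> 'I_n -> R) (hc : structure_constants A c)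
    (U : set 'rV[R]_k) (hU : open U)
    (phi : 'rV[R]_k -> 'rV[R]_n) (hphi : differentiable_on U phi)
    (f : 'rV[R]_k -> 'rV[R]_n) (hf : phiA_differentiable A U phi f) :
  [/\ (* each component of the product equations is the displayed expression *)
      forall g : 'rV[R]_k -> 'rV[R]_n, differentiable_on U g ->
        forall u, U u -> forall (i j : 'I_k) (q : 'I_n),
          (amul A ('d phi u (ebase j)) (dvec g i u)
           - amul A ('d phi u (ebase i)) (dvec g j u)) 0 q
          = CR_lhs c phi g i j q u,
      (* the two systems of PDEs are the same *)
      forall g : 'rV[R]_k -> 'rV[R]_n, differentiable_on U g ->
        (CR_product_system A U phi g <-> CR_system c U phi g),
      (* f is a solution *)
      CR_product_system A U phi f /\ CR_system c U phi f &
      (* number of equations: n * (1 + 2 + ... + (k - 1)) *)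
      #|CR_index k n| = (n * \sum_(1 <= i < k) i)%N].
Proof.
have Hf := phiA_differentiable_CR hf.
split.
- by move=> g _ u Uu i j q; apply: CR_lhs_coord => //; apply: hphi.
- by move=> g _; apply: CR_product_systemE.
- by split=> //; apply/(CR_product_systemE _ hc hphi).
- exact: card_CR_index.
Qed.
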